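(* Let $X_n$ be the number of correct guesses (under the optimal strategy, with complete feedback) for a deck of $n$ cards riffle shuffled exactly once. Then for $n\ge 2$ the following equality in distribution holds: $$X_n \overset{\mathcal{L}}{=} I_1\big(X^{\ast}_{n-1}+1\big)+(1-I_1)\Big(I_2\cdot n+(1-I_2)\cdot C_{n-1-J_n,J_n}\Big),$$ where $I_1$ is Bernoulli distributed with $\mathbb{P}(I_1=1)=\frac12$, $I_2$ is Bernoulli distributed with $\mathbb{P}(I_2=1)=\frac{1}{2^{n-1}}$, $C_{m_1,m_2}$ denotes the number of correct guesses in the two-color card guessing game with $m_1$ and $m_2$ cards, $X^{\ast}_{n-1}$ is an independent copy of $X_{n-1}$ (the variable $X$ defined on $n-1$ cards), and $J_n$ has the truncated binomial distribution $$\mathbb{P}(J_n=j)=\frac{\binom{n-1}{j}}{2^{n-1}-1},\quad 0\le j\le n-2.$$ All random variables $I_1$, $I_2$, $J_n$, as well as $C_{m_1,m_2}$, are mutually independent.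
   Context: One-time riffle shuffle (Gilbert–Shannon–Reeds model): an ordered deck $1,2,\dots,n$ is cut after the first $k$ cards with probability $\binom{n}{k}/2^n$, $0\le k\le n$, and the two packets $1,\dots,k$ and $k+1,\dots,n$ are interleaved uniformly at random, keeping the relative order within each packet. Equivalently: choose a word $w\in\{a,b\}^n$ uniformly at random among the $2^n$ words; if $w$ has $k$ letters $a$, replace the $a$'s from left to right by $1,2,\dots,k$ and the $b$'s from left to right by $k+1,\dots,n$; the resulting sequence $\sigma=(\sigma_1,\dots,\sigma_n)$ is the shuffled deck read from top to bottom. Guessing game with complete feedback: the cards are drawn one after another from the top; before each draw the guesser guesses the label of the next card, and then the drawn card is shown. The guesser uses the optimal strategy (maximizing the number of correct guesses): as long as all previous guesses were correct, the guesser guesses label $j$ for the $j$-th card. When this fails for the first time, say the $j$-th card has label $m>j$, the cut is known to have been at $m-1$, and the remaining cards form an interleaving of the two increasing sequences $j,j+1,\dots,m-1$ and $m+1,\dots,n$; from then on the guesser always guesses the smallest remaining label of the currently longer of the two remaining sequences (in case of equal lengths, either choice). $X_n$ denotes the total number of correct guesses, with $X_0=0$. Two-color card guessing game with complete feedback: a deck of $m_1\ge0$ cards of one color and $m_2\ge0$ cards of another color is in uniformly random order (all $\binom{m_1+m_2}{m_1}$ color sequences equally likely). Cards are drawn one by one; before each draw the guesser guesses the color, always choosing the color with more remaining cards (in case of a tie, either color), and then the card is shown. $C_{m_1,m_2}$ is the number of correct guesses; its distribution is symmetric in $m_1,m_2$. The variable $C_{n-1-J_n,J_n}$ means $C_{m_1,m_2}$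 evaluated at the random index $(m_1,m_2)=(n-1-J_n,J_n)$, with $J_n$ independent of the family $(C_{m_1,m_2})$. *)

(* Defs.v *)
(* Library: Mathematical Components with MathComp-Analysis. *)
From HB Require Import structures.
From mathcomp Require Import all_boot all_order all_algebra.
From mathcomp Require Import all_classical all_reals all_analysis.
Set Implicit Arguments.
Unset Strict Implicit.
Unset Printing Implicit Defensive.
Import Order.TTheory GRing.Theory Num.Theory.
Local Open Scope classical_set_scope.
Local Open Scope ring_scope.

(* A strategy maps the history (the items shown so far, in order of appearance)
   to the guess for the next item.  [hits_from g h s] counts the correct guesses
   while [s] is shown after [h]. *)
Fixpoint hits_from (T : eqType) (g : seq T -> T) (h s : seq T) : nat :=
  if s is x :: s' then ((g h == x) + hits_from g (rcons h x) s')%N else 0%N.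

Definition hits (T : eqType) (g : seq T -> T) (s : seq T) : nat :=
  hits_from g [::] s.

(* In a word over {a, b}, the letter a is [true] and the letter b is [false]. *)

Fixpoint relabel (x y : nat) (w : seq bool) : seq nat :=
  if w is c :: w' then
    if c then x :: relabel x.+1 y w' else y :: relabel x y.+1 w'
  else [::].

(* The shuffled deck, from top to bottom: the a's become 1, ..., k and
   the b's become k+1, ..., n, where k is the number of a's. *)
Definition riffle (w : seq bool) : seq nat := relabel 1 (count_mem true w).+1 w.

(* The 0-based position of the first card of [h] that differs from its
   1-based position; it is [size h] if there is none. *)
Definition first_miss (h : seq nat) : nat :=
  find (fun i => nth 0%N h i != i.+1) (iota 0 (size h)).

(* [x] is an admissible guess after the history [h].  If the first miss is at
   the j-th card, with label m, the remaining cards are those of j, ..., m-1 and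
   of m+1, ..., n that have not been shown; both lists are increasing, so their
   heads are their smallest labels.  In case of equal lengths both heads are
   admissible. *)
Definition riffle_guess (n : nat) (h : seq nat) (x : nat) : bool :=
  if first_miss h == size h then x == (size h).+1
  else
    let j := (first_miss h).+1 in
    let m := nth 0%N h (first_miss h) in
    let lo := [seq y <- iota j (m - j) | y \notin h] in
    let hi := [seq y <- iota m.+1 (n - m) | y \notin h] in
    ((size hi <= size lo)%N && (x == head 0%N lo))
    || ((size lo <= size hi)%N && (x == head 0%N hi)).

(* [h] ranges over the histories at which a card is still to be drawn.  Ties
   may be broken in any way, depending on the whole history. *)
Definition riffle_strategy (n : nat) (g : seq nat -> nat) : Prop :=
  forall (w : n.-tuple bool) (h s : seq nat),
    riffle w = h ++ s -> s != [::] -> riffle_guess n h (g h).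

(* The words with [m1] cards of the first color ([true]) and [m2] cards of the
   second color ([false]). *)
Definition color_decks (m1 m2 : nat) : {set (m1 + m2).-tuple bool} :=
  [set t : (m1 + m2).-tuple bool | count_mem true t == m1].

Definition color_guess (m1 m2 : nat) (h : seq bool) (c : bool) : bool :=
  let r1 := (m1 - count_mem true h)%N in
  let r2 := (m2 - count_mem false h)%N in
  if c then (r2 <= r1)%N else (r1 <= r2)%N.

Definition color_strategy (m1 m2 : nat) (g : seq bool -> bool) : Prop :=
  forall (t : (m1 + m2).-tuple bool) (h s : seq bool),
    t \in color_decks m1 m2 -> tval t = h ++ s -> s != [::] ->
    color_guess m1 m2 h (g h).

(* The probability mass function of [f t] for [t] uniform on [A]. *)
Definition uniform_law (R : realType) (T : finType) (A : {set T}) (f : T -> nat)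
    (x : nat) : R :=
  #|[set t in A | f t == x]|%:R / #|A|%:R.

(* The law of X_n. *)
Definition riffle_law (R : realType) (n : nat) (g : seq nat -> nat) : nat -> R :=
  uniform_law R [set: n.-tuple bool] (fun w => hits g (riffle w)).

(* The law of C_{m1,m2}. *)
Definition color_law (R : realType) (m1 m2 : nat) (g : seq bool -> bool) :
    nat -> R :=
  uniform_law R (color_decks m1 m2) (fun t => hits g t).

Definition has_law (R : realType) (d : measure_display) (T : measurableType d)
    (P : probability T R) (X : T -> nat) (p : nat -> R) : Prop :=
  forall x : nat, P (X @^-1` [set x]) = (p x)%:E.

(* The sigma-algebra generated by a family of functions. *)
Definition sigma_family (d d' : measure_display) (T : measurableType d)
    (U : measurableType d') (K : Type) (X : K -> T -> U) : set (set T) :=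
  <<s \bigcup_k preimage_set_system setT (X k) measurable >>.

Definition sigma_rv (d d' : measure_display) (T : measurableType d)
    (U : measurableType d') (X : T -> U) : set (set T) :=
  sigma_family (fun _ : unit => X).

Definition mutually_independent (R : realType) (d : measure_display)
    (T : measurableType d) (P : probability T R) (K : finType)
    (F : K -> set (set T)) : Prop :=
  forall (S : {set K}) (E : K -> set T),
    (forall k, k \in S -> F k (E k)) ->
    P (\bigcap_(k in [set` S]) E k) = (\prod_(k in S) P (E k))%E.

(* Main.v *)
(* Condition on the first letter of the riffling word.  An a leaves a riffled
   deck of n - 1 cards with all labels increased by one, after a certain hit.
   A b leaves the ordered deck, with n hits, if the word has no a; otherwise the
   first guess is a miss, and from then on guessing the head of the longer list
   is guessing the color of the next card of a uniformly shuffled two-color deck.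
   Strategies may break ties at will, so laws must be shown not to depend on
   this: at a tie the two colors are exchangeable, and flipping the colors makes
   two strategies agree on the first guess. *)
Require Import Defs.
From HB Require Import structures.
From mathcomp Require Import all_boot all_order all_algebra.
From mathcomp Require Import all_classical all_reals all_analysis.
From mathcomp Require Import zify ring.
Import Order.TTheory GRing.Theory Num.Theory.

Set Implicit Arguments.
Unset Strict Implicit.
Unset Printing Implicit Defensive.
Local Open Scope nat_scope.

(** * Guessing games and words, read one letter at a time *)

Lemma hits_from_cons (T : eqType) (g : seq T -> T) x h s :
  hits_from g (x :: h) s = hits_from (g \o cons x) h s.
Proof. by elim: s h => //= y s IHs h; rewrite IHs. Qed.

Lemma hits_cons (T : eqType) (g : seq T -> T) x s :
  hits g (x :: s) = (g [::] == x) + hits (g \o cons x) s.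
Proof. by rewrite /hits /= hits_from_cons. Qed.

Lemma count_true_false (w : seq bool) :
  count_mem true w + count_mem false w = size w.
Proof. by elim: w => //= -[] w <- /=; lia. Qed.

(** [F] takes sequences, not tuples, so that the splitting can be iterated without casts. *)
Lemma sum_tuple_bool n (F : seq bool -> nat) :
  \sum_(w : n.+1.-tuple bool) F w =
  \sum_(w : n.-tuple bool) F (true :: w) + \sum_(w : n.-tuple bool) F (false :: w).
Proof.
transitivity (\sum_(c : bool) \sum_(w : n.-tuple bool) F (c :: w)); last first.
  by rewrite big_bool.
rewrite pair_big /=.
rewrite (reindex (fun p : bool * n.-tuple bool => [tuple of p.1 :: p.2])) //=.
exists (fun t : n.+1.-tuple bool => (thead t, [tuple of behead t])) => [[c w]|t] _.
  by congr pair; apply/val_inj.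
by rewrite -tuple_eta.
Qed.

Lemma sum_tuple_bool_map_negb n (F : seq bool -> nat) :
  \sum_(w : n.-tuple bool) F (map negb w) = \sum_(w : n.-tuple bool) F w.
Proof.
elim: n F => [|n IHn] F.
  by apply: eq_bigr => w _; rewrite (tuple0 w).
rewrite !sum_tuple_bool (sum_tuple_bool _ (fun w => F (map negb w))) /=.
by rewrite addnC (IHn (fun w => F (true :: w))) (IHn (fun w => F (false :: w))).
Qed.

Lemma sum_count_true n k :
  \sum_(w : n.-tuple bool) (count_mem true w == k) = 'C(n, k).
Proof.
elim: n k => [|n IHn] k.
  rewrite (big_pred1 [tuple]) => [|w]; last by rewrite (tuple0 w) /= eqxx.
  by case: k.
rewrite (sum_tuple_bool _ (fun w => (count_mem true w == k) : nat)) /=.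
case: k => [|k]; last by rewrite binS addnC -!IHn.
rewrite big1 ?add0n // -[RHS](bin0 n) -IHn.
by apply: eq_bigr.
Qed.

(** * The two-color game: its law does not depend on how ties are broken *)

Definition color_count n m1 (p : seq bool -> bool) (x : nat) :=
  \sum_(w : n.-tuple bool) ((count_mem true w == m1) && (hits p w == x)).

(** Replaces tuples of the dependent length [m1 + m2] by sequences with prescribed letter counts,
    which are easier to extend and to flip. *)
Lemma color_strategyP m1 m2 p :
  color_strategy m1 m2 p <->
  forall h s, count_mem true (h ++ s) = m1 -> count_mem false (h ++ s) = m2 ->
    s != [::] -> color_guess m1 m2 h (p h).
Proof.
split=> [H h s e1 e2 s0|H t h s]; last first.
  rewrite inE => /eqP e1 e s0; apply: (H h s) => //; rewrite -e //.
  by have := count_true_false t; rewrite size_tuple; lia.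
have sz : size (h ++ s) == m1 + m2 by rewrite -count_true_false e1 e2.
by apply: (H (Tuple sz) h s) => //; rewrite inE /= e1.
Qed.

Lemma color_strategy_cons (m1 m2 : nat) (c : bool) p :
  color_strategy (c + m1) (~~ c + m2) p -> color_strategy m1 m2 (p \o cons c).
Proof.
move=> /color_strategyP H; apply/color_strategyP => h s e1 e2 s0.
have := H (c :: h) s; rewrite !cat_cons /= e1 e2.
rewrite /color_guess /=; case: c {H} => /= /(_ erefl erefl s0);
  by rewrite !(add0n, add1n, subSS).
Qed.

Definition flip_strategy (p : seq bool -> bool) (h : seq bool) :=
  ~~ p (map negb h).

Lemma count_map_negb c (w : seq bool) :
  count_mem c (map negb w) = count_mem (~~ c) w.
Proof. by rewrite count_map; apply: eq_count => -[]; case: c. Qed.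

Lemma color_strategy_flip m1 m2 p :
  color_strategy m1 m2 p -> color_strategy m2 m1 (flip_strategy p).
Proof.
move=> /color_strategyP H; apply/color_strategyP => h s e1 e2 s0.
have := H (map negb h) (map negb s); rewrite -map_cat !count_map_negb /=.
rewrite -size_eq0 size_map size_eq0 => /(_ e2 e1 s0).
by rewrite /color_guess /flip_strategy !count_map_negb /=; case: ifP.
Qed.

Lemma hits_flip p w : hits (flip_strategy p) (map negb w) = hits p w.
Proof.
elim: w p => //= c w IHw p; rewrite !hits_cons -(IHw (p \o cons c)).
congr (_ + _); first by rewrite /flip_strategy /=; case: (p _) c => -[].
by congr hits; apply/funext => h; rewrite /flip_strategy /= negbK.
Qed.

Lemma color_count_flip m1 m2 p x :
  color_count (m1 + m2) m2 (flip_strategy p) x = color_count (m1 + m2) m1 p x.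
Proof.
rewrite /color_count -(sum_tuple_bool_map_negb _ (fun w =>
  ((count_mem true w == m2) && (hits (flip_strategy p) w == x)) : nat)).
apply: eq_bigr => w _; rewrite hits_flip count_map_negb /=.
congr (nat_of_bool (_ && _)).
move: (count_true_false w); rewrite size_tuple => e.
move: e; set a := count _ _; set b := count _ _ => e.
by apply/eqP/eqP => ?; move: e; lia.
Qed.

(** Induction on the deck size: once the first guesses agree, conditioning on the first card leaves
    two optimal strategies for a smaller deck. *)
Lemma color_count_unique m1 m2 p p' x :
  color_strategy m1 m2 p -> color_strategy m1 m2 p' ->
  color_count (m1 + m2) m1 p x = color_count (m1 + m2) m1 p' x.
Proof.
move: {1 3 4}(m1 + m2) (erefl (m1 + m2)) => r er.
elim: r => [|r IHr] in m1 m2 er p p' x *.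
  by move=> _ _; apply: eq_bigr => w _; rewrite (tuple0 w).
move=> hp hp'; wlog epp' : p' hp' / p [::] = p' [::].
  move=> W; case: (p [::] =P p' [::]) => [/W -> //|ne].
  have em : m1 = m2.
    (* A strategy is constrained only on histories of actual decks, so a nonempty deck is exhibited
       before the guesses at [[::]] are compared. *)
    have [c [w [e1 e2]]] : exists c w,
        count_mem true (c :: w) = m1 /\ count_mem false (c :: w) = m2.
      case: m1 er {W hp hp'} => [|m1] er.
        exists false, (nseq r false); rewrite /= !count_nseq /= mul0n mul1n; lia.
      exists true, (nseq m1 true ++ nseq m2 false).
      by rewrite /= !count_cat !count_nseq /= !mul0n !mul1n; lia.
    have /(_ isT) := (iffLR (color_strategyP _ _ _) hp) [::] (c :: w) e1 e2.
    have := (iffLR (color_strategyP _ _ _) hp') [::] (c :: w) e1 e2.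
    move=> /(_ isT); move: ne; rewrite /color_guess !subn0.
    by case: (p _); case: (p' _) => // _; lia.
  (* Distinct first guesses occur only at a tie, where flipping [p'] is allowed. *)
  subst m2; rewrite er -[RHS](color_count_flip m1 m1) -er; apply: W.
    exact: color_strategy_flip.
  by rewrite /flip_strategy /=; case: (p _) (p' _) ne => -[].
rewrite /color_count !(sum_tuple_bool _ (fun w =>
  ((count_mem true w == m1) && (hits _ w == x)) : nat)).
under eq_bigr do rewrite hits_cons /= epp'.
under [X in _ + X = _]eq_bigr do rewrite hits_cons /= epp'.
under [X in _ = X + _]eq_bigr do rewrite hits_cons /=.
under [X in _ = _ + X]eq_bigr do rewrite hits_cons /=.
set b := p' [::].
(* The induction hypothesis with an offset [y], the hit or miss on the first card; for [y > x] both
   sums vanish. *)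
have H (f : seq bool -> bool) f' m1' m2' (y : nat) : m1' + m2' = r ->
   color_strategy m1' m2' f -> color_strategy m1' m2' f' ->
   \sum_(w : r.-tuple bool) ((count_mem true w == m1') && (y + hits f w == x)) =
   \sum_(w : r.-tuple bool) ((count_mem true w == m1') && (y + hits f' w == x)).
  move=> er' hf hf'; case: (leqP y x) => yx; last first.
    by rewrite !big1 // => w _; rewrite (_ : (_ + _ == _) = false) ?andbF //; lia.
  have E f0 (w : r.-tuple bool) : (y + hits f0 w == x) = (hits f0 w == x - y) by lia.
  under eq_bigr do rewrite E; under [RHS]eq_bigr do rewrite E.
  by have := IHr _ _ (esym er') f f' (x - y) hf hf'; rewrite /color_count.
congr (_ + _).
  case: m1 er hp hp' => [|m1] er hp hp'; first by rewrite !big1.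
  under eq_bigr do rewrite add1n eqSS; under [RHS]eq_bigr do rewrite add1n eqSS.
  by apply: (H _ _ _ m2); [lia|apply: (color_strategy_cons (c := true))..].
(* Without cards of the second color, [m1 = r.+1] exceeds the length [r] of the words, so both sums
   are zero. *)
case: m2 er hp hp' => [|m2] er hp hp'.
  rewrite !big1 // => w _; case: eqP => //= e; move: (count_true_false w);
    by rewrite size_tuple; move: er; rewrite -e;
      set a := count _ _; set c := count _ _; lia.
under eq_bigr do rewrite add0n; under [RHS]eq_bigr do rewrite add0n.
by apply: (H _ _ _ m2); [lia|apply: (color_strategy_cons (c := false))..].
Qed.

(** * First letter a: every later label goes up by one *)

Lemma relabel_succ x y w : relabel x.+1 y.+1 w = map S (relabel x y w).
Proof. by elim: w x y => //= -[] w IHw x y; rewrite IHw. Qed.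

Lemma relabel_cat x y u v :
  relabel x y (u ++ v) =
  relabel x y u ++ relabel (x + count_mem true u) (y + count_mem false u) v.
Proof.
elim: u x y => [|[] u IHu] x y /=; rewrite ?addn0 // IHu;
by rewrite /= add0n add1n addSnnS.
Qed.

Lemma mem_relabel x y (w : seq bool) z :
  (z \in relabel x y w) =
  (x <= z < x + count_mem true w) || (y <= z < y + count_mem false w).
Proof.
elim: w x y => [|[] w IHw] x y /=; rewrite ?inE ?IHw; first by lia.
  by set a := count _ _; set b := count _ _; lia.
by set a := count _ _; set b := count _ _; lia.
Qed.

Lemma relabel_nseq_true x y n : relabel x y (nseq n true) = iota x n.
Proof. by elim: n x => //= n IHn x; rewrite IHn. Qed.

Lemma relabel_nseq_false x y n : relabel x y (nseq n false) = iota y n.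
Proof. by elim: n y => //= n IHn y; rewrite IHn. Qed.

Lemma riffle_true w : riffle (true :: w) = 1 :: map S (riffle w).
Proof. by rewrite /riffle /= add1n relabel_succ. Qed.

Lemma riffle_nseq c n : riffle (nseq n c) = iota 1 n.
Proof.
case: c; rewrite /riffle ?relabel_nseq_true //.
by rewrite relabel_nseq_false count_nseq /= mul0n.
Qed.

Lemma first_miss_cons1 h : first_miss (1 :: map S h) = (first_miss h).+1.
Proof.
rewrite /first_miss /= size_map; congr S.
rewrite -[1]/(1 + 0) iotaDl find_map; apply: eq_in_find => i.
by rewrite mem_iota /= => hi; rewrite (nth_map 0).
Qed.

Lemma filter_iota_succ h i k :
  [seq y <- iota i.+2 k | y \notin 1 :: map S h] =
  map S [seq y <- iota i.+1 k | y \notin h].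
Proof.
rewrite -(add1n i.+1) iotaDl filter_map (eq_map add1n).
(* Only [y = 0] could be an exception, its successor 1 being already shown; the range starts at
   [i.+1] and avoids it. *)
congr (map S _); apply: eq_in_filter => -[|y]; rewrite mem_iota //= => _.
by rewrite add1n inE eqSS (mem_map succn_inj).
Qed.

(** Covers empty lists too: the default 0 of [head] is its own predecessor. *)
Lemma head_map_S l x : x == head 0 (map S l) -> x.-1 == head 0 l.
Proof. by case: l => [|y l] /= /eqP ->. Qed.

Definition shift_strategy (g : seq nat -> nat) (h : seq nat) : nat :=
  (g (1 :: map S h)).-1.

(** With a certain hit put in front, the first miss, its label and both remaining lists all move up
    by one, so the comparison of lengths is unchanged. *)
Lemma riffle_guess_succ n h x :
  riffle_guess n.+1 (1 :: map S h) x -> riffle_guess n h x.-1.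
Proof.
rewrite /riffle_guess first_miss_cons1 /= size_map eqSS.
case: ifP => [_ /eqP -> //|ne].
(* Hence [nth] reads a real entry of [h]; its default 0 would not commute with [map S]. *)
have lt : first_miss h < size h.
  rewrite ltn_neqAle ne /= /first_miss.
  by rewrite -[X in _ <= X](size_iota 0) find_size.
rewrite (nth_map 0) //= !subSS !filter_iota_succ !size_map.
by case/orP => /andP[-> /head_map_S ->]; rewrite ?orbT.
Qed.

Lemma riffle_strategyP n g :
  riffle_strategy n g <->
  forall w h s, size w = n -> riffle w = h ++ s -> s != [::] ->
    riffle_guess n h (g h).
Proof.
split=> [H w h s /eqP sw|H w h s]; last by apply: H; rewrite size_tuple.
exact: (H (Tuple sw)).
Qed.

Lemma shift_riffle_strategy n g :
  riffle_strategy n.+1 g -> riffle_strategy n (shift_strategy g).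
Proof.
move=> /riffle_strategyP H; apply/riffle_strategyP => w h s sw e s0.
apply/riffle_guess_succ/(H (true :: w) _ (map S s)); first by rewrite /= sw.
  by rewrite riffle_true e map_cat.
by rewrite -size_eq0 size_map size_eq0.
Qed.

(** Labels must be positive: a guess 0 misses every [x.+1], while its predecessor, again 0, would
    hit a label 0. *)
Lemma hits_map_succ (g : seq nat -> nat) s : all (leq 1) s ->
  hits g (map S s) = hits (fun h => (g (map S h)).-1) s.
Proof.
elim: s g => //= x s IHs g /andP[x0 s1]; rewrite !hits_cons IHs //.
by congr (nat_of_bool _ + _) => /=; case: (g [::]) x0 => [|y] /=; lia.
Qed.

Lemma hits_riffle_true n g w : riffle_strategy n.+1 g -> size w = n ->
  hits g (riffle (true :: w)) = (hits (shift_strategy g) (riffle w)).+1.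
Proof.
move=> /riffle_strategyP H sw; rewrite riffle_true hits_cons hits_map_succ.
  have /eqP -> : riffle_guess n.+1 [::] (g [::]).
    by apply: (H (true :: w)); rewrite /= ?sw // riffle_true.
  by rewrite eqxx add1n.
by apply/allP => z; rewrite mem_relabel => /orP[] /andP[+ _] //; exact: leq_trans.
Qed.

Lemma hits_riffle_nseq n c g : riffle_strategy n g ->
  hits g (riffle (nseq n c)) = n.
Proof.
(* Either constant word gives the ordered deck, so it suffices to treat all a's, one certain hit at
   a time. *)
move=> H; rewrite riffle_nseq -(riffle_nseq true).
elim: n g H => [|n IHn] g H //.
by rewrite (hits_riffle_true H) ?size_nseq // IHn //; exact: shift_riffle_strategy.
Qed.

(** * First letter b with some a left: reduction to the two-color game *)

(* The color strategy obtained from [g] once the first card [k.+1] is shown: the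
   first color stands for the labels up to [k], the second one for those above. *)
Definition color_of_riffle k (g : seq nat -> nat) (u : seq bool) : bool :=
  g (k.+1 :: relabel 1 k.+2 u) <= k.

(** The low labels already shown are [1, ..., count_mem true u]; the card [k.+1] and the high labels
    lie outside the range. *)
Lemma filter_iota_relabel_lo k (u : seq bool) : count_mem true u <= k ->
  [seq y <- iota 1 k | y \notin k.+1 :: relabel 1 k.+2 u] =
  iota (1 + count_mem true u) (k - count_mem true u).
Proof.
move=> le; rewrite -[in LHS](subnKC le) iotaD filter_cat.
rewrite (eq_in_filter (a2 := pred0)) ?filter_pred0 => [|y]; last first.
  rewrite mem_iota inE mem_relabel; move: le; set a := count _ _; set b := count _ _.
  by move=> le /= yl; apply/negbF; lia.
rewrite /= (eq_in_filter (a2 := predT)) ?filter_predT => // y.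
rewrite mem_iota inE mem_relabel; move: le; set a := count _ _; set b := count _ _.
by move=> le /= yl; lia.
Qed.

Lemma filter_iota_relabel_hi k l (u : seq bool) :
  count_mem true u <= k -> count_mem false u <= l ->
  [seq y <- iota k.+2 l | y \notin k.+1 :: relabel 1 k.+2 u] =
  iota (k.+2 + count_mem false u) (l - count_mem false u).
Proof.
move=> le0 le; rewrite -[in LHS](subnKC le) iotaD filter_cat.
rewrite (eq_in_filter (a2 := pred0)) ?filter_pred0 => [|y]; last first.
  rewrite mem_iota inE mem_relabel; move: le0 le.
  set a := count _ _; set b := count _ _.
  by move=> le0 le /= yl; apply/negbF; lia.
rewrite /= (eq_in_filter (a2 := predT)) ?filter_predT => // y.
rewrite mem_iota inE mem_relabel; move: le0 le.
set a := count _ _; set b := count _ _.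
by move=> le0 le /= yl; lia.
Qed.

(** The second conjunct recovers the guessed label from the guessed color, which turns hits on
    labels into hits on colors. *)
Lemma riffle_strategy_false k l g (u v : seq bool) :
  0 < k -> riffle_strategy (k + l).+1 g ->
  count_mem true (u ++ v) = k -> count_mem false (u ++ v) = l -> v != [::] ->
  let c := color_of_riffle k g u in
  color_guess k l u c /\
  g (k.+1 :: relabel 1 k.+2 u) =
    if c then 1 + count_mem true u else k.+2 + count_mem false u.
Proof.
move=> k0 /riffle_strategyP H e1 e2 v0.
set h := _ :: _.
have : riffle_guess (k + l).+1 h (g h).
  apply: (H (false :: (u ++ v)) _
    (relabel (1 + count_mem true u) (k.+2 + count_mem false u) v)).
  - by rewrite /= -e1 -e2 count_true_false.
  - by rewrite /riffle /= e1 relabel_cat.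
  - case: v v0 {e1 e2} => [|[] v] //.
have sz := count_true_false v.
have {}v0 : 0 < size v by case: v v0 {e1 e2 sz}.
move: e1 e2 sz; rewrite !count_cat; set a := count _ u; set b := count _ u.
set a' := count _ v; set b' := count _ v => e1 e2 sz.
(* As [k > 0], the first card [k.+1] is not 1: the miss occurs at once. *)
have fm : first_miss h = 0.
  by rewrite /first_miss /= ifT //; lia.
have ak : a <= k by lia.
have bl : b <= l by lia.
have := filter_iota_relabel_lo ak; have := filter_iota_relabel_hi ak bl.
rewrite -/h -/a -/b => ehi elo.
rewrite /riffle_guess fm /= subSS addKn subn1 /= ehi elo.
rewrite !size_iota /color_of_riffle -/h /color_guess -/a -/b.
(* A card is left, so the longer list is nonempty and the default of [head] is never guessed. *)
clearbody a b a' b'; have hd x m : 0 < m -> head 0 (iota x m) = x by case: m.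
case/orP => /andP[le /eqP ->]; rewrite hd; try lia.
  by have -> : 1 + a <= k by lia.
have -> : (k.+2 + b <= k) = false by lia.
by split.
Qed.

Lemma color_of_riffle_strategy k l g : 0 < k -> riffle_strategy (k + l).+1 g ->
  color_strategy k l (color_of_riffle k g).
Proof.
move=> k0 H; apply/color_strategyP => h s e1 e2 s0.
by have [] := riffle_strategy_false k0 H e1 e2 s0.
Qed.

Lemma relabel_rcons x y u c :
  relabel x y (rcons u c) =
  rcons (relabel x y u) (if c then x + count_mem true u else y + count_mem false u).
Proof. by rewrite -!cats1 relabel_cat; case: c. Qed.

Lemma hits_riffle_false k l g (w : seq bool) :
  0 < k -> riffle_strategy (k + l).+1 g ->
  count_mem true w = k -> count_mem false w = l ->
  hits g (riffle (false :: w)) = hits (color_of_riffle k g) w.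
Proof.
move=> k0 H e1 e2; have /= H0 := riffle_strategy_false k0 H.
rewrite /riffle /= e1 add0n hits_cons.
have /riffle_strategyP H' := H.
have -> : (g [::] == k.+1) = false.
  have /eqP -> : riffle_guess (k + l).+1 [::] (g [::]); last by case: (k) k0.
  apply: (H' (false :: w) _ (riffle (false :: w))) => //.
  by rewrite /= -count_true_false e1 e2.
rewrite add0n /hits -hits_from_cons.
have -> : relabel 1 k.+2 w =
  relabel (1 + count_mem true [::]) (k.+2 + count_mem false [::]) w.
  by rewrite /= !addn0.
have -> : [:: k.+1] = k.+1 :: relabel 1 k.+2 [::] by [].
(* Generalizes the empty history to any prefix [u] of the word; the two next labels advance with its
   letter counts. *)
move: e1 e2; rewrite -{1 2}[w]cat0s; move: [::] => u.
elim: w u => [|c w IHw] u e1 e2 //=.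
have {}IHw := IHw (rcons u c); rewrite !cat_rcons in IHw.
have [_ Hg] := H0 _ _ e1 e2 isT.
rewrite -(IHw e1 e2) relabel_rcons -!cats1 !count_cat /= !addn0.
have le_uk : count_mem true u <= k by rewrite -e1 count_cat leq_addr.
set a := count_mem true u; set b := count_mem false u.
set x := if c then 1 + a else k.+2 + b.
have -> : (if c then 1 + a :: relabel (1 + a).+1 (k.+2 + b) w
           else k.+2 + b :: relabel (1 + a) (k.+2 + b).+1 w) =
  x :: relabel (1 + (a + (c == true))) (k.+2 + (b + (c == false))) w.
  by rewrite /x; case: (c); rewrite ?addn0 ?addn1 ?addnS.
rewrite /= Hg -/a -/b -cats1; congr (nat_of_bool _ + _).
(* [a <= k] puts the low label [1 + a] below the high label [k.+2 + b], so labels agree exactly when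
   colors do. *)
move: le_uk; rewrite /x -/a => le_ak.
by case: (color_of_riffle _ _ _); case: (c); lia.
Qed.

(** * A recurrence for the number of words with [x] hits *)

Definition riffle_count n g x :=
  \sum_(w : n.-tuple bool) (hits g (riffle w) == x).

Lemma count_true0_nseq (w : seq bool) :
  count_mem true w = 0 -> w = nseq (size w) false.
Proof. by elim: w => //= -[] //= w IHw /IHw {1}->. Qed.

(** Words starting with b are sorted by the number [j] of b's among the other [n] letters; [j = n]
    is the ordered deck. The first sum still involves [g], since independence of [g] is deduced from
    this identity. *)
Lemma riffle_count_shift n g q x : riffle_strategy n.+1 g ->
  (forall m1 m2, color_strategy m1 m2 (q m1 m2)) ->
  riffle_count n.+1 g x =
  \sum_(w : n.-tuple bool) ((hits (shift_strategy g) (riffle w)).+1 == x) +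
  (\sum_(j < n) color_count n (n - j) (q (n - j) j) x + (n.+1 == x)).
Proof.
move=> H hq; rewrite /riffle_count.
rewrite (sum_tuple_bool _ (fun w => (hits g (riffle w) == x) : nat)).
congr (_ + _).
  by apply: eq_bigr => w _; rewrite (hits_riffle_true H) // size_tuple.
pose F (w : seq bool) := hits g (riffle (false :: w)) == x.
have count_le (w : n.-tuple bool) : count_mem true w <= n.
  by rewrite -[X in _ <= X](size_tuple w) count_size.
transitivity (\sum_(w : n.-tuple bool) \sum_(j < n.+1)
    ((count_mem true w == n - j) && F w)).
  apply: eq_bigr => w _; move: (count_le w); set a := count _ _ => le.
  (* The only nonzero term is the one where [j] is the number [n - a] of b's. *)
  rewrite (bigD1 (inord (n - a))) //= inordK; last by lia.
  rewrite subKn // eqxx big1 ?addn0 // => j ne.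
  case: eqP => // e; case/eqP: ne; apply/val_inj; rewrite /= inordK; last by lia.
  by have := ltn_ord j; lia.
rewrite exchange_big /= big_ord_recr /=; congr (_ + _).
  apply: eq_bigr => j _.
  have jn := ltn_ord j; have k0 : 0 < n - j by lia.
  have en : n - j + j = n by lia.
  have H' : riffle_strategy (n - j + j).+1 g by rewrite en.
  have := color_count_unique x (color_of_riffle_strategy k0 H') (hq (n - j) j).
  rewrite en => <-; apply: eq_bigr => w _; case: eqP => //= e.
  rewrite /F (hits_riffle_false k0 H' e) //.
  by move: (count_true_false w); rewrite size_tuple e; lia.
rewrite subnn (eq_bigr (fun w : n.-tuple bool =>
  (count_mem true w == 0) * (n.+1 == x))) => [|w _].
  by rewrite -big_distrl /= sum_count_true bin0 mul1n.
case: eqP => //= e; rewrite mul1n /F.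
have -> : false :: w = nseq n.+1 false :> seq bool.
  by rewrite {1}(count_true0_nseq e) size_tuple.
by rewrite (hits_riffle_nseq false H).
Qed.

(** Provides an auxiliary family for [riffle_count_unique], whose statement has none; ties go to the
    first color. *)
Lemma color_strategy_exists : exists q : nat -> nat -> seq bool -> bool,
  forall m1 m2, color_strategy m1 m2 (q m1 m2).
Proof.
exists (fun m1 m2 h =>
  m2 - count_mem false h <= m1 - count_mem true h) => m1 m2 t h s _ _ _.
by rewrite /color_guess; case: ifP => //; lia.
Qed.

(** In the recurrence the terms of the first letter b do not mention [g], so the induction only
    concerns the first letter a. *)
Lemma riffle_count_unique n g g' x :
  riffle_strategy n g -> riffle_strategy n g' ->
  riffle_count n g x = riffle_count n g' x.
Proof.
elim: n g g' x => [|n IHn] g g' x hg hg'.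
  by apply: eq_bigr => w _; rewrite (tuple0 w).
have [q hq] := color_strategy_exists.
rewrite !(riffle_count_shift _ _ hq) //; congr (_ + _).
case: x => [|x]; first by rewrite !big1.
by apply: IHn; exact: shift_riffle_strategy.
Qed.

Lemma riffle_count_succ n g g' q x :
  riffle_strategy n.+1 g -> riffle_strategy n g' ->
  (forall m1 m2, color_strategy m1 m2 (q m1 m2)) ->
  riffle_count n.+1 g x = (if x is x'.+1 then riffle_count n g' x' else 0) +
  (\sum_(j < n) color_count n (n - j) (q (n - j) j) x + (n.+1 == x)).
Proof.
move=> hg hg' hq; rewrite (riffle_count_shift x hg hq); congr (_ + _).
case: x => [|x]; first by rewrite big1.
by apply: riffle_count_unique => //; exact: shift_riffle_strategy.
Qed.

(** * From counts to laws *)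

Lemma riffle_lawE (R : realType) n g x :
  riffle_law R n g x = ((riffle_count n g x)%:R / 2 ^+ n)%R.
Proof.
rewrite /riffle_law /uniform_law cardsT card_tuple card_bool natrX.
congr (_%:R / _)%R; rewrite /riffle_count -sum1_card [RHS]big_mkcond /=.
rewrite big_mkcond; apply: eq_bigr => w _.
by rewrite !inE; case: eqP.
Qed.

Lemma color_lawE (R : realType) n m1 m2 g x : m1 + m2 = n ->
  color_law R m1 m2 g x = ((color_count n m1 g x)%:R / 'C(n, m1)%:R)%R.
Proof.
move=> <-; rewrite /color_law /uniform_law; congr (_%:R / _%:R)%R.
  rewrite /color_count -sum1_card big_mkcond; apply: eq_bigr => w _.
  by rewrite !inE; case: (_ && _).
rewrite -sum_count_true -sum1_card big_mkcond; apply: eq_bigr => w _.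
by rewrite !inE; case: (_ == _).
Qed.

Local Open Scope classical_set_scope.
Local Open Scope ring_scope.

(** * Independence and total probability *)

Lemma sigma_family_preimage (d d' : measure_display) (T : measurableType d)
    (U : measurableType d') (K : Type) (X : K -> T -> U) k (B : set U) :
  measurable B -> sigma_family X (X k @^-1` B).
Proof.
by move=> mB; apply: sub_sigma_algebra; exists k => //; exists B; rewrite ?setTI.
Qed.

Lemma mutually_independent5 (R : realType) (d : measure_display)
    (T : measurableType d) (P : probability T R) (F0 F1 F2 F3 F4 : set (set T))
    (A0 A1 A2 A3 A4 : set T) :
  mutually_independent P (tnth [tuple F0; F1; F2; F3; F4]) ->
  F0 A0 -> F1 A1 -> F2 A2 -> F3 A3 -> F4 A4 ->
  P (A0 `&` A1 `&` A2 `&` A3 `&` A4) = (P A0 * P A1 * P A2 * P A3 * P A4)%E.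
Proof.
move=> hind h0 h1 h2 h3 h4.
have := hind [set: 'I_5]%SET (tnth [tuple A0; A1; A2; A3; A4]).
rewrite (_ : \bigcap_(k in _) _ = A0 `&` A1 `&` A2 `&` A3 `&` A4).
  move=> ->; last first.
    by case=> -[|[|[|[|[|k]]]]] hk _ //; rewrite !(tnth_nth set0).
  under eq_bigl do rewrite inE.
  by rewrite !big_ord_recl big_ord0 !(tnth_nth set0) /= mule1 !muleA.
apply/seteqP; split => t /=.
  move=> h; have {}h k := h k (finset.in_setT k).
  do !split; [have := h (inord 0)|have := h (inord 1)|have := h (inord 2)|
    have := h (inord 3)|have := h (inord 4)];
    by rewrite (tnth_nth set0) inordK.
move=> [[[[t0 t1] t2] t3] t4] [[|[|[|[|[|k]]]]] hk] _ //;
  by rewrite (tnth_nth set0).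
Qed.

(** [J] may take values from [m] on, but only on a null set, since the masses below [m] already sum
    to 1. *)
Lemma probability_partition_nat (R : realType) (d : measure_display)
    (T : measurableType d) (P : probability T R) (J : {RV P >-> nat}) m (E : set T) :
  measurable E -> (\sum_(j < m) P (J @^-1` [set (j : nat)]) = 1)%E ->
  (P E = \sum_(j < m) P (E `&` J @^-1` [set (j : nat)]))%E.
Proof.
move=> mE hsum.
have mJ B : measurable (J @^-1` B) by exact: measurable_funPTI.
have tJ (A : set T) : trivIset setT (fun j : 'I_m => A `&` J @^-1` [set (j : nat)]).
  apply/trivIsetP => i j _ _ ij; apply/seteqP; split=> // t /=.
  by move=> [[_ ->] [_]] /val_inj /eqP; rewrite (negbTE ij).
have bigJ (A : set T) : measurable A ->
    (\sum_(j < m) P (A `&` J @^-1` [set (j : nat)]) =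
     P (A `&` J @^-1` [set k | (k < m)%N]))%E.
  move=> mA; rewrite -measure_semi_additive_ord //; first last.
  - by apply: bigsetU_measurable => j _; exact: measurableI.
  - by move=> j; exact: measurableI.
  congr (P _); rewrite -(bigcup_mkord m (fun j => A `&` J @^-1` [set j])).
  apply/seteqP; split => t /=.
    by move=> [j jm [At ->]].
  by move=> [At lt]; exists (J t).
have J0 : P (J @^-1` (~` [set k | (k < m)%N])) = 0%E.
  rewrite preimage_setC probability_setC; last by apply: (mJ [set k | (k < m)%N]).
  have := bigJ _ measurableT; rewrite !setTI => <-.
  by under eq_bigr do rewrite setTI; rewrite hsum subee.
rewrite bigJ // -[in LHS](setIT E) -(preimage_setT J).
rewrite -(setUv [set k | (k < m)%N]) preimage_setU setIUr measureU0 //.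
- exact: measurableI.
- exact: measurableI.
apply: (@subset_measure0 _ _ _ P _ (J @^-1` (~` [set k | (k < m)%N]))) => //.
exact: measurableI.
Qed.

Unset Implicit Arguments.

Theorem theorem2 (R : realType) (n : nat) (hn : (2 <= n)%N)
  (g g' : seq nat -> nat)
  (hg : riffle_strategy n g) (hg' : riffle_strategy n.-1 g')
  (q : nat -> nat -> seq bool -> bool)
  (hq : forall m1 m2 : nat, color_strategy m1 m2 (q m1 m2))
  (d : measure_display) (T : measurableType d) (P : probability T R)
  (I1 I2 : {RV P >-> bool}) (X' J : {RV P >-> nat})
  (C : nat -> nat -> {RV P >-> nat})
  (hI1 : P (I1 @^-1` [set true]) = (1 / 2)%:E)
  (hI2 : P (I2 @^-1` [set true]) = (1 / 2 ^+ n.-1)%:E)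
  (hX' : has_law P X' (riffle_law R n.-1 g'))
  (hJ : forall j : nat, (j <= n - 2)%N ->
     P (J @^-1` [set j]) = ('C(n.-1, j)%:R / (2 ^+ n.-1 - 1))%:E)
  (hC : forall m1 m2 : nat, has_law P (C m1 m2) (color_law R m1 m2 (q m1 m2)))
  (hind : mutually_independent P
     (tnth [tuple sigma_rv I1; sigma_rv I2; sigma_rv X'; sigma_rv J;
                  sigma_family (fun m : nat * nat => C m.1 m.2)])) :
  has_law P
    (fun t => (I1 t * (X' t + 1)
               + (1 - I1 t) * (I2 t * n
                               + (1 - I2 t) * C (n.-1 - J t) (J t) t))%N)
    (riffle_law R n g).
Proof.
move=> x; case: n hn => [//|m] m1 in hg hg' hI2 hX' hJ *.
rewrite /= in hI2 hX' hJ hg' *.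
(* The denominator of the law of [J]; it is nonzero because [n >= 2] gives [m >= 1]. *)
have pow0 : (2 ^+ m - 1 : R) != 0.
  rewrite subr_eq0 -natrX pnatr_eq1.
  by case: m m1 {hg hg' hI2 hX' hJ} => // m _; rewrite expnS; lia.
have mX d' (U : measurableType d') (X : {RV P >-> U}) B :
    measurable B -> measurable (X @^-1` B).
  by move=> mB; exact: measurable_funPTI.
(* Choosing [setT] for some of the [B]'s drops the corresponding variables. *)
have ind B1 B2 B3 B4 k l B5 :
    P (I1 @^-1` B1 `&` I2 @^-1` B2 `&` X' @^-1` B3 `&` J @^-1` B4
       `&` C k l @^-1` B5) =
    (P (I1 @^-1` B1) * P (I2 @^-1` B2) * P (X' @^-1` B3) * P (J @^-1` B4)
     * P (C k l @^-1` B5))%E.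
  apply: (mutually_independent5 hind).
  - exact: (sigma_family_preimage (X := fun _ : unit => I1 : T -> bool) tt).
  - exact: (sigma_family_preimage (X := fun _ : unit => I2 : T -> bool) tt).
  - exact: (sigma_family_preimage (X := fun _ : unit => X' : T -> nat) tt).
  - exact: (sigma_family_preimage (X := fun _ : unit => J : T -> nat) tt).
  - exact: (sigma_family_preimage
      (X := fun p : nat * nat => C p.1 p.2 : T -> nat) (k, l)).
have Pfalse (I : {RV P >-> bool}) :
    (P (I @^-1` [set false]) = 1 - P (I @^-1` [set true]))%E.
  rewrite -probability_setC; last exact: mX.
  congr (P _); apply/seteqP; split => t /=; first by move=> ->.
  by case: (I t).
have PI1f : P (I1 @^-1` [set false]) = (1 / 2)%:E.
  by rewrite Pfalse hI1 -EFinB; congr (_%:E); field.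
have PI2f : P (I2 @^-1` [set false]) = (1 - 1 / 2 ^+ m)%:E.
  by rewrite Pfalse hI2 -EFinB.
(* The event that the right-hand side equals [x] splits into [A] (first letter a), [B] (ordered
   deck) and [E] (two-color game). *)
pose A := I1 @^-1` [set true] `&` X' @^-1` [set y | y.+1 = x].
pose B := I1 @^-1` [set false] `&` I2 @^-1` [set true] `&` [set _ | m.+1 = x].
pose E := I1 @^-1` [set false] `&` I2 @^-1` [set false]
          `&` [set t | C (m - J t)%N (J t) t = x].
have constT (Q : Prop) : Q -> [set _ : T | Q] = setT.
  by move=> holds; apply/seteqP; split.
have const0 (Q : Prop) : ~ Q -> [set _ : T | Q] = set0.
  by move=> nq; apply/seteqP; split.
have mA : measurable A by apply: measurableI; exact: mX.
have mB : measurable B.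
  apply: measurableI; first by apply: measurableI; exact: mX.
  by have [e|ne] := pselect (m.+1 = x); rewrite ?(constT _ e) ?(const0 _ ne).
have mE : measurable E.
  apply: measurableI; first by apply: measurableI; exact: mX.
  (* The index of [C] is random: measurability comes from a countable union over the values of
     [J]. *)
  rewrite (_ : mkset _ =
    \bigcup_j (J @^-1` [set j] `&` C (m - j)%N j @^-1` [set x])).
    by apply: bigcupT_measurable => j; apply: measurableI; exact: mX.
  by apply/seteqP; split => [t Ct|t [j _ [<-]]] //; exists (J t).
have PA : P A = (1 / 2 * ((if x is x'.+1 then riffle_count m g' x' else 0)%:R
    / 2 ^+ m))%:E.
  have := ind [set true] setT [set y | y.+1 = x] setT 0 0 setT.
  rewrite !preimage_setT !setIT probability_setT !mule1 => ->.
  rewrite EFinM -hI1; congr (_ * _)%E.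
  case: x {A B E mA mB mE} => [|x].
    rewrite mul0r (_ : mkset _ = set0) ?preimage_set0 ?measure0 //.
    by apply/seteqP; split.
  rewrite -riffle_lawE -hX'; congr (P (_ @^-1` _)).
  by apply/seteqP; split => y /=; [case|move=> ->].
have PB : P B = (1 / 2 * (1 / 2 ^+ m) * (m.+1 == x)%:R)%:E.
  rewrite /B; case: eqP => xn; last first.
    by rewrite mulr0 (const0 _ xn) setI0 measure0.
  rewrite mulr1 (constT _ xn).
  have := ind [set false] [set true] setT setT 0 0 setT.
  by rewrite !preimage_setT !setIT probability_setT !mule1 PI1f hI2 EFinM.
(* The binomial coefficients sum to [2 ^+ m], and the truncation removes the term [j = m], equal to
   1. *)
have PJ : (\sum_(j < m) P (J @^-1` [set (j : nat)]) = 1)%E.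
  rewrite (eq_bigr (fun j : 'I_m => ('C(m, j)%:R / (2 ^+ m - 1))%:E)) => [|j _].
    rewrite sumEFin -big_distrl /=.
    rewrite (_ : \sum_(j < m) _ = 2 ^+ m - 1) ?divff //.
    have := exprD1n (1 : R) m; rewrite -[1 + 1]/(2 : R) => ->.
    rewrite big_ord_recr /= binn expr1n mulr1n addrK.
    by apply: eq_bigr => j _; rewrite expr1n.
  by apply: hJ; have := ltn_ord j; lia.
(* The factor [1 - 1 / 2 ^+ m] of [I2] cancels [2 ^+ m - 1] up to [1 / 2 ^+ m], and the binomial
   weight of [J] cancels the number of color decks. *)
have PE : P E = (1 / 2 ^+ m.+1 *
    (\sum_(j < m) color_count m (m - j) (q (m - j)%N j) x)%:R)%:E.
  rewrite (probability_partition_nat mE PJ).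
  rewrite natr_sum big_distrr /= -sumEFin; apply: eq_bigr => j _.
  (* On [J = j] the index of [C] is constant, so independence applies. *)
  rewrite (_ : E `&` _ = I1 @^-1` [set false] `&` I2 @^-1` [set false] `&`
      X' @^-1` setT `&` J @^-1` [set (j : nat)] `&` C (m - j)%N j @^-1` [set x]).
    have jm := ltn_ord j.
    have bin0 : ('C(m, j)%:R : R) != 0 by rewrite pnatr_eq0 -lt0n bin_gt0 ltnW.
    have pm0 : (2 ^+ m : R) != 0 by rewrite expf_neq0 // pnatr_eq0.
    rewrite ind preimage_setT probability_setT mule1 PI1f PI2f hC hJ; last by lia.
    have jm' := ltnW jm.
    rewrite (color_lawE R (q (m - j)%N j) x (subnK jm')) (bin_sub jm').
    rewrite -!EFinM; congr (_%:E).
    by rewrite exprS; field; rewrite pow0 bin0 pm0.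
  rewrite preimage_setT setIT; apply/seteqP; split => t /=.
    by move=> [[[? ?] ?] <-].
  by rewrite /E /= => -[[[? ?] ->] ?].
have -> : (fun t => (I1 t * (X' t + 1) + (1 - I1 t) *
    (I2 t * m.+1 + (1 - I2 t) * C (m - J t) (J t) t))%N) @^-1` [set x] =
    A `|` (B `|` E).
  apply/seteqP; split => t /=; rewrite /A /B /E /=.
    case: (I1 t); first by left; split=> //; lia.
    by case: (I2 t) => e; right; [left|right]; split=> //; lia.
  by case=> [[-> <-]|[[[-> ->] <-]|[[-> ->] <-]]]; lia.
have disjABE : A `&` (B `|` E) = set0.
  by apply/seteqP; split => t //=; rewrite /A /B /E /= => -[[-> _] [[[]]|[[]]]].
have disjBE : B `&` E = set0.
  by apply/seteqP; split => t //=; rewrite /B /E /= => -[[[_ ->] _] [[_]]].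
have -> : (P (A `|` (B `|` E)) = P A + (P B + P E))%E.
  rewrite measureU //; last exact: measurableU.
  by congr (_ + _)%E; rewrite measureU.
rewrite PA PB PE -!EFinD; congr (_%:E).
(* Over the common denominator [2 ^+ m.+1], the three probabilities are the three terms of the
   recurrence. *)
rewrite riffle_lawE (riffle_count_succ x hg hg' hq) !natrD exprS.
have pm0 : (2 ^+ m : R) != 0 by rewrite expf_neq0 // pnatr_eq0.
by field.
Qed.
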